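(* Let $N\ge 2$, $R>0$, and let $\alpha=(\alpha_1,\dots,\alpha_N)$ be such that $\alpha_i>0$ for $i=1,\dots,N$. Let $\mathrm{Rect}(\alpha)=\prod_{i=1}^N(-\alpha_i^{-1}R,\alpha_i^{-1}R)$. Then the principal eigenvalue of $\mathcal{P}^+_1$ in $\mathrm{Rect}(\alpha)$ is $$\mu_1^+=\frac{1}{\frac{1}{\alpha_1^2}+\dots+\frac{1}{\alpha_N^2}}\left(\frac{\pi}{2R}\right)^2.$$ Moreover there exists $p=(p_1,\dots,p_N)$ with $p_i>-1$ for every $i=1,\dots,N$, such that $$u(x)=\prod_{i=1}^N\left(\cos\left(\frac{\pi}{2R}\alpha_i x_i\right)\right)^{\frac{1}{p_i+1}}$$ is a principal eigenfunction of $\mathcal{P}^+_1$ in $\mathrm{Rect}(\alpha)$.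
   Context: For a symmetric real $N\times N$ matrix $X$, $\mathcal{P}^+_1(X)=\lambda_N(X)$ denotes its largest eigenvalue. For a bounded domain $\Omega\subset\mathbb{R}^N$, the principal eigenvalue of $\mathcal{P}^+_1$ in $\Omega$ is $$\mu_1^+=\mu_1^+(\Omega)=\sup\{\mu\in\mathbb{R} : \exists\, \phi>0 \text{ in } \Omega,\ \mathcal{P}^+_1(D^2\phi)+\mu\phi\le 0 \text{ in }\Omega\},$$ where $\phi$ is lower semicontinuous and the inequality is understood in the viscosity sense. A principal eigenfunction of $\mathcal{P}^+_1$ in $\Omega$ is a function $u$, continuous on $\overline\Omega$, with $u>0$ in $\Omega$, $u=0$ on $\partial\Omega$ and $\mathcal{P}^+_1(D^2u)+\mu_1^+u=0$ in $\Omega$. *)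

(* Defs.v *)
From HB Require Import structures.
From mathcomp Require Import all_boot all_order all_algebra.
From mathcomp Require Import all_classical all_reals all_analysis.

Set Implicit Arguments.
Unset Strict Implicit.
Unset Printing Implicit Defensive.

Import Order.TTheory GRing.Theory Num.Theory.
Import numFieldNormedType.Exports.

Local Open Scope classical_set_scope.
Local Open Scope ring_scope.

Section Viscosity.
Context {R : realType} {N : nat}.
Implicit Types (Omega : set 'rV[R]_N) (u phi : 'rV[R]_N -> R).

(* The set of eigenvalues is finite, and it is nonempty when X is symmetric
   and N > 0, so that the supremum is then a maximum. *)
Definition largest_eigenvalue (X : 'M[R]_N) : R :=
  sup [set a : R | eigenvalue X a].

Definition partial (i : 'I_N) phi : 'rV[R]_N -> R := 'D_(delta_mx 0 i) phi.

Definition hessian phi (x : 'rV[R]_N) : 'M[R]_N :=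
  \matrix_(i, j) partial i (partial j phi) x.

(* phi is of class C^2 in the open set Omega. *)
Definition C2_on Omega phi : Prop := forall x, Omega x ->
  [/\ {for x, continuous phi},
      forall i : 'I_N, derivable phi x (delta_mx 0 i)
                       /\ {for x, continuous (partial i phi)} &
      forall i j : 'I_N, derivable (partial j phi) x (delta_mx 0 i)
                       /\ {for x, continuous (partial i (partial j phi))}].

(* Semicontinuity is relative to Omega: the values of u outside of Omega are
   irrelevant because points outside of Omega are isolated in
   [subspace Omega]. *)
Definition lsc_on Omega u : Prop :=
  lower_semicontinuous (fun x : subspace Omega => (u x)%:E).

Definition usc_on Omega u : Prop := lsc_on Omega (fun x => - u x).

(* P_1^+(D^2 u) + mu u <= 0 in the open set Omega, in the viscosity sense;
   a test function touches u from below, up to an additive constant. *)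
Definition viscosity_supersolution Omega (mu : R) u : Prop :=
  lsc_on Omega u /\
  forall x phi, Omega x -> C2_on Omega phi ->
    (\forall y \near x, u x - phi x <= u y - phi y) ->
    largest_eigenvalue (hessian phi x) + mu * u x <= 0.

(* P_1^+(D^2 u) + mu u >= 0 in the open set Omega, in the viscosity sense. *)
Definition viscosity_subsolution Omega (mu : R) u : Prop :=
  usc_on Omega u /\
  forall x phi, Omega x -> C2_on Omega phi ->
    (\forall y \near x, u y - phi y <= u x - phi x) ->
    0 <= largest_eigenvalue (hessian phi x) + mu * u x.

Definition viscosity_solution Omega (mu : R) u : Prop :=
  viscosity_supersolution Omega mu u /\ viscosity_subsolution Omega mu u.

(* The supremum is taken in the extended reals, so that it is meaningful even
   before the set is known to be nonempty and bounded above. *)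
Definition principal_eigenvalue Omega : \bar R :=
  ereal_sup [set mu%:E | mu in [set mu : R | exists phi,
    (forall x, Omega x -> 0 < phi x) /\ viscosity_supersolution Omega mu phi]].

Definition principal_eigenfunction Omega u : Prop :=
  [/\ {within closure Omega, continuous u},
      forall x, Omega x -> 0 < u x,
      forall x, (closure Omega `\` interior Omega) x -> u x = 0 &
      exists2 mu : R, principal_eigenvalue Omega = mu%:E &
                      viscosity_solution Omega mu u].

Definition Rect (r : R) (alpha : 'I_N -> R) : set 'rV[R]_N :=
  [set x | forall i, - ((alpha i)^-1 * r) < x 0 i < (alpha i)^-1 * r].

End Viscosity.

(* Main.v *)
(** With b_i = pi alpha_i / (2 r), the rectangle is [|b_i x_i| < pi / 2].  For
    weights [e_i = mu / b_i^2] of sum 1, the function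
    [u(x) = prod_i cos(b_i x_i)^e_i] has the Hessian
      [u (- mu I - mu diag(t_i^2) + w w^T)], [t_i = tan(b_i x_i)],
      [w_i = e_i b_i t_i],
    and [(sum_i w_i v_i)^2 <= mu sum_i t_i^2 v_i^2] by convexity of the square,
    with equality for some [v != 0]; hence its largest eigenvalue is [- mu u].

    Near each point, u lies between two functions exp(quadratic polynomial)
    that touch it there and whose Hessians are those of u up to [+- eps u I].
    These are smooth everywhere, so comparing them with test functions gives
    the viscosity inequalities.  If [phi > 0] were a supersolution for some
    [nu > mu], one would take u for a slightly smaller rectangle, maximize
    [u / phi] on its closure, and use the lower comparison function as a test
    function for phi at the maximum point, which contradicts [nu > mu]. *)

Require Import Defs.
From HB Require Import structures.
From mathcomp Require Import all_boot all_order all_algebra.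
From mathcomp Require Import all_classical all_reals all_analysis.
From mathcomp Require Import ring lra.

Set Implicit Arguments.
Unset Strict Implicit.
Unset Printing Implicit Defensive.

Import Order.TTheory GRing.Theory Num.Theory.
Import numFieldNormedType.Exports.

Local Open Scope classical_set_scope.
Local Open Scope ring_scope.

(** * Second-order conditions in one variable *)

Lemma nbhs_distP (R : realType) (V : normedModType R) (x : V) (P : set V) :
  (\forall y \near x, P y) <->
  exists2 d, 0 < d & forall y, `|y - x| < d -> P y.
Proof.
rewrite nbhs_normP; split=> -[d d0 Pd]; exists d => // y yd;
  by apply: Pd; rewrite /= distrC.
Qed.

Lemma is_deriveP (R : realType) (V : normedModType R) (f : V -> R) (x v : V)
    (c : R) :
  is_derive x v f c <->
  forall e, 0 < e -> exists2 d, 0 < d &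
    forall h, h != 0 -> `|h| < d -> `|(f (x + h *: v) - f x) / h - c| < e.
Proof.
have E : is_derive x v f c <->
    h^-1 *: ((f \o shift x) (h *: v) - f x) @[h --> 0^'] --> c.
  split=> [[dx <-]|cv]; first exact: dx.
  split; first by apply/cvg_ex; exists c.
  exact/cvg_lim.
rewrite E; split=> [/cvgrPdist_lt cv e e0|H].
  have [d d0 dP] := (nbhs_distP (0 : R)
    (fun h => h != 0 -> `|c - h^-1 *: ((f \o shift x) (h *: v) - f x)| < e)).1
    (cv e e0).
  exists d => // h h0 hd; rewrite distrC.
  have := dP h; rewrite subr0 => /(_ hd h0) /=.
  by rewrite [_ *: (_ - _)]mulrC (addrC (h *: v)).
apply/cvgrPdist_lt => e e0; have [d d0 dP] := H e e0.
apply/(nbhs_distP (0 : R)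
    (fun h => h != 0 -> `|c - h^-1 *: ((f \o shift x) (h *: v) - f x)| < e)).
exists d => // h; rewrite subr0 => hd h0.
by rewrite /= [_ *: (_ - _)]mulrC (addrC (h *: v)) distrC; exact: dP.
Qed.

Section SecondOrder.
Variable R : realType.
Implicit Types f df : R -> R.

(** Since [df y / (y - x)] is close to [c > 0], [df y] has the sign of [y - x] near [x]. The mean
    value theorem on the segment between [x] and [y] then gives the strict inequality on both
    sides. *)
Lemma second_order_min f df (x c : R) :
  (\forall y \near x, is_derive (y : R) 1 f (df y)) -> df x = 0 ->
  is_derive x 1 df c -> 0 < c -> \forall y \near x, y != x -> f x < f y.
Proof.
move=> /nbhs_distP[d d0 fdf] dfx0 /is_deriveP dfc c0.
have [d' d'0 dP] := dfc _ c0.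
have sgn (y : R) : y != x -> `|y - x| < d' -> 0 < df y / (y - x).
  move=> yx yd; have := dP (y - x); rewrite subr_eq0 => /(_ yx yd).
  rewrite dfx0 subr0 [_%:A]mulr1 subrKC ltr_norml => /andP[]; lra.
apply/nbhs_distP; exists (Num.min d d'); first by rewrite lt_min d0.
move=> y; rewrite lt_min => /andP[yd yd'] yx.
have mvt (a b : R) : a < b -> (forall z, a <= z <= b -> `|z - x| < d) ->
    exists2 z, a < z < b & f b - f a = df z * (b - a).
  move=> ab H; have [||z] := @MVT R f df a b ab.
  - by move=> z /itvP zab; apply: fdf; apply: H; rewrite !zab.
  - apply: derivable_within_continuous => z; rewrite in_itv/= => zab.
    by have [] := fdf z (H _ zab).
  by rewrite in_itv/=; exists z.
move: yd yd' yx; rewrite !ltr_norml => /andP[yd1 yd2] /andP[yd3 yd4].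
rewrite neq_lt => /orP[] yx.
  have [z zz|z /andP[yz zx] E] := mvt _ _ yx.
    by rewrite ltr_norml; apply/andP; split; lra.
  have /sgn : z != x by rewrite lt_eqF.
  rewrite ltr_norml => /(_ _)/wrap[]; first by apply/andP; split; lra.
  rewrite nmulr_lgt0 ?invr_lt0 ?subr_lt0// => dz.
  by rewrite -subr_lt0 E nmulr_rlt0// subr_gt0.
have [z zz|z /andP[xz zy] E] := mvt _ _ yx.
  by rewrite ltr_norml; apply/andP; split; lra.
have /sgn : z != x by rewrite gt_eqF.
rewrite ltr_norml => /(_ _)/wrap[]; first by apply/andP; split; lra.
rewrite pmulr_lgt0 ?invr_gt0 ?subr_gt0// => dz.
by rewrite -subr_gt0 E pmulr_rgt0// subr_gt0.
Qed.

(** Subtracting the quadratic polynomial leaves a function with zero first derivative and second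
    derivative [c - 2 m > 0] at [x], hence with a strict local minimum there. *)
Lemma taylor2_le f df (x c m : R) :
  (\forall y \near x, is_derive (y : R) 1 f (df y)) -> is_derive x 1 df c ->
  m *+ 2 < c ->
  \forall y \near x, f x + df x * (y - x) + m * (y - x) ^+ 2 <= f y.
Proof.
move=> fdf dfc mc.
pose g y := f y - (df x * (y - x) + m * (y - x) ^+ 2).
pose dg y := df y - (df x + m * (y - x) *+ 2).
have gdg : \forall y \near x, is_derive (y : R) 1 g (dg y).
  near=> y; have dy : is_derive (y : R) 1 f (df y) by near: y.
  apply: is_derive_eq.
  by rewrite /dg /GRing.scale/=; ring.
have dgc : is_derive x 1 dg (c - m *+ 2).
  by apply: is_derive_eq; rewrite /GRing.scale/=; ring.
have := second_order_min gdg _ dgc; rewrite subr_gt0 => /(_ _ mc).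
rewrite /dg subrr mulr0 mul0rn addr0 subrr => /(_ erefl).
apply: filterS => y; have [->|yx] := eqVneq y x.
  by rewrite subrr; lra.
move=> /(_ isT); rewrite /g subrr; lra.
Unshelve. all: by end_near. Qed.

(** The first derivative vanishes at an interior maximum. If [c] were positive, [x] would also be a
    strict local minimum, which is impossible. *)
Lemma second_order_max f df (x c : R) :
  (\forall y \near x, is_derive (y : R) 1 f (df y)) -> is_derive x 1 df c ->
  (\forall y \near x, f y <= f x) -> c <= 0.
Proof.
move=> fdf dfc fmax; rewrite leNgt; apply/negP => c0.
move: (fdf) (fmax) => /nbhs_distP[d d0 fdf'] /nbhs_distP[d' d'0 fmax'].
pose d1 := Num.min d d'; have d10 : 0 < d1 by rewrite lt_min d0.
have d1d : d1 <= d by rewrite ge_min lexx.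
have d1d' : d1 <= d' by rewrite ge_min lexx orbT.
have dfx : df x = 0.
  have [_ <-] := fdf' x (ltac:(by rewrite subrr normr0)).
  suff [] : is_derive x 1 f 0 by [].
  apply: (@derive1_at_max R f (x - d1) (x + d1) x); first lra.
  - move=> t; rewrite in_itv/= => /andP[t1 t2]; have [] // := fdf' t _.
    by rewrite ltr_norml; apply/andP; split; lra.
  - by rewrite in_itv/=; apply/andP; split; lra.
  - move=> t; rewrite in_itv/= => /andP[t1 t2]; apply: fmax'.
    by rewrite ltr_norml; apply/andP; split; lra.
have := second_order_min fdf dfx dfc c0; move: fmax.
move=> /nbhs_distP[e e0 fmax] /nbhs_distP[e' e'0 fmin].
pose e1 := Num.min e e'; have e10 : 0 < e1 by rewrite lt_min e0.
have : `|x + e1 / 2 - x| < e1 by rewrite addrC addKr gtr0_norm; lra.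
rewrite lt_min => /andP[/fmax le1 /fmin].
rewrite ltNge le1 => /(_ _)/wrap[]//.
by rewrite gt_eqF//; lra.
Qed.

End SecondOrder.

(** * Directional derivatives and Hessians of C^2 functions *)

Section Directional.
Variables (R : realType) (V : normedModType R).
Implicit Types (f : V -> R) (x y e : V).

Lemma is_derive_line f y e (t c : R) :
  is_derive (y + t *: e) e f c -> is_derive t 1 (fun s => f (y + s *: e)) c.
Proof.
move=> /is_deriveP fc; apply/is_deriveP => eps eps0.
have [d d0 dP] := fc _ eps0; exists d => // h h0 hd.
by rewrite [_%:A]mulr1 scalerDl addrA; exact: dP.
Qed.

Lemma MVT_line f y e (s : R) :
  (forall t : R, `|t| <= `|s| -> derivable f (y + t *: e) e) ->
  exists2 t : R, `|t| <= `|s| &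
    f (y + s *: e) - f y = s * 'D_e f (y + t *: e).
Proof.
move=> df; pose g t := f (y + t *: e).
pose dg (t : R) : R := 'D_e f (y + t *: e).
have gdg (t : R) : `|t| <= `|s| -> is_derive t 1 g (dg t).
  by move=> ts; apply/is_derive_line/derivableP/df.
have cg (a b : R) : (forall t : R, a <= t <= b -> `|t| <= `|s|) ->
    {within `[a, b], continuous g}.
  move=> H; apply: derivable_within_continuous => z; rewrite in_itv/= => zab.
  by have [] := gdg z (H _ zab).
have g0 : g 0 = f y by rewrite /g scale0r addr0.
have [s0|s0] := leP 0 s.
  have H (t : R) : 0 <= t <= s -> `|t| <= `|s|.
    by move=> /andP[t0 ts]; rewrite !ger0_norm.
  have [||t] := @MVT_segment R g dg 0 s s0.
  - by move=> z /itvP zs; apply/gdg/H; rewrite !zs.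
  - exact: cg.
  rewrite in_itv/= => /H ts; rewrite g0 subr0 mulrC => E.
  by exists t.
have H (t : R) : s <= t <= 0 -> `|t| <= `|s|.
  by move=> /andP[t0 ts]; rewrite !ler0_norm ?lerN2// ltW.
have [||t] := @MVT_segment R g dg s 0 (ltW s0).
- by move=> z /itvP zs; apply/gdg/H; rewrite !zs.
- exact: cg.
rewrite in_itv/= => /H ts; rewrite g0 sub0r => E.
by exists t => //; rewrite -[LHS]opprB -/(g s) E mulrN opprK mulrC.
Qed.

(** By the mean value theorem along [e], the increment is [h * c] times the derivative at an
    intermediate point, and this derivative tends to ['D_e f x] by continuity. It is the induction
    step that adds one coordinate to a direction. *)
Lemma is_derive_partial_step f x e (w : V) (c : R) :
  (\forall y \near x, derivable f y e) -> {for x, continuous ('D_e f)} ->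
  forall eps, 0 < eps -> exists2 d, 0 < d & forall h : R, h != 0 -> `|h| < d ->
    `|(f (x + h *: (w + c *: e)) - f (x + h *: w)) / h - c * 'D_e f x| < eps.
Proof.
move=> /nbhs_distP[d0 d00 df] /cvgrPdist_lt cf eps eps0.
have c10 : 0 < `|c| + 1 by rewrite ltr_wpDl.
have /cf/nbhs_distP[d1 d10 fd] : 0 < eps / (`|c| + 1) by rewrite divr_gt0.
(* [|h| * M] bounds the distance to [x] of every point on the segment from [x + h *: w] to
   [x + h *: (w + c *: e)]. *)
pose M := `|w| + `|c| * `|e| + 1.
have M0 : 0 < M by rewrite ltr_wpDl// addr_ge0// mulr_ge0.
exists (Num.min d0 d1 / M); first by rewrite divr_gt0// lt_min d00.
move=> h h0; rewrite ltr_pdivlMr// => hM.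
have near_x (t : R) : `|t| <= `|h * c| ->
    `|x + h *: w + t *: e - x| < Num.min d0 d1.
  move=> ht; rewrite -[x + _ + _]addrA [x + _]addrC addrK (le_lt_trans _ hM)//.
  rewrite (le_trans (ler_normD _ _))// !normrZ /M 2!mulrDr mulr1 -addrA lerD2l.
  rewrite -[leLHS]addr0 lerD//.
  by rewrite (le_trans (ler_wpM2r _ ht))// normrM mulrA.
have md0 : Num.min d0 d1 <= d0 by rewrite ge_min lexx.
have [t ht E] := @MVT_line f (x + h *: w) e (h * c) (fun t ht => df _
  (lt_le_trans (near_x t ht) md0)).
rewrite scalerDr addrA scalerA E mulrAC (mulrC h) mulfK//.
rewrite -mulrBr normrM.
have : `|'D_e f x - 'D_e f (x + h *: w + t *: e)| < eps / (`|c| + 1).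
  by apply: fd; rewrite (lt_le_trans (near_x t ht))// ge_min lexx orbT.
rewrite distrC ltr_pdivlMr// mulrC; apply: le_lt_trans.
by rewrite ler_wpM2r// lerDl.
Qed.
End Directional.

Section Multi.
Variables (R : realType) (N : nat).
Implicit Types (f : 'rV[R]_N -> R) (x y v : 'rV[R]_N) (Omega : set 'rV[R]_N).

Lemma is_derive_partials f x v :
  (forall i, \forall y \near x, derivable f y (delta_mx 0 i)) ->
  (forall i, {for x, continuous (partial i f)}) ->
  is_derive x v f (\sum_i v 0 i * partial i f x).
Proof.
move=> df cf.
(* The direction is built up one coordinate at a time, by induction on a list of indices. *)
suff main (s : seq 'I_N) eps : 0 < eps -> exists2 d, 0 < d &
    forall h : R, h != 0 -> `|h| < d ->
    `|(f (x + h *: \sum_(i <- s) v 0 i *: delta_mx 0 i) - f x) / h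
       - \sum_(i <- s) v 0 i * partial i f x| < eps.
  apply/is_deriveP => eps /main - /(_ (index_enum _))[d d0 dP].
  by exists d => // h h0 hd; rewrite {1}[v]row_sum_delta; exact: dP.
elim: s eps => [|i s IH] eps eps0.
  exists 1 => // h _ _.
  by rewrite !big_nil scaler0 addr0 subrr mul0r subr0 normr0.
have e2 : 0 < eps / 2 by rewrite divr_gt0.
have [d d0 dP] := IH _ e2.
have [d' d'0 dP'] := is_derive_partial_step
  (\sum_(j <- s) v 0 j *: delta_mx 0 j) (v 0 i) (df i) (cf i) e2.
exists (Num.min d d'); first by rewrite lt_min d0.
move=> h h0; rewrite lt_min => /andP[/(dP _ h0) A /(dP' _ h0) B].
rewrite !big_cons [_ *: _ + _]addrC.
set a := f _ in B *; set b := f _ in A B *.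
have -> : (a - f x) / h -
    (v 0 i * partial i f x + \sum_(j <- s) v 0 j * partial j f x) =
    ((b - f x) / h - \sum_(j <- s) v 0 j * partial j f x) +
    ((a - b) / h - v 0 i * partial i f x) by ring.
by rewrite (le_lt_trans (ler_normD _ _))// [eps]splitr ltrD.
Qed.

Definition qform (H : 'M[R]_N) v : R := \sum_i \sum_j v 0 i * v 0 j * H i j.

Lemma near_line x v (P : set 'rV[R]_N) :
  (\forall y \near x, P y) -> \forall t \near (0 : R), P (x + t *: v).
Proof.
move=> /nbhs_distP[d d0 xP]; apply/nbhs_distP.
have v0 : 0 < `|v| + 1 by rewrite ltr_wpDl.
exists (d / (`|v| + 1)); first by rewrite divr_gt0.
move=> t; rewrite subr0 ltr_pdivlMr// => td; apply: xP.
by rewrite addrC addKr normrZ (le_lt_trans _ td)// ler_wpM2l// lerDl.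
Qed.

(** Reduces second-order conditions to one variable: [is_derive_partials] is applied to [f] near
    [x], then to each of its partial derivatives at [x]. *)
Lemma C2_line Omega f x v : open Omega -> C2_on Omega f -> Omega x ->
  (\forall t \near (0 : R), is_derive (t : R) 1 (fun s : R => f (x + s *: v))
     (\sum_j v 0 j * partial j f (x + t *: v))) /\
  is_derive (0 : R) 1 (fun s : R => \sum_j v 0 j * partial j f (x + s *: v))
    (qform (hessian f x) v).
Proof.
move=> oO fC2 Ox.
have nO y : Omega y -> \forall z \near y, Omega z.
  by move=> Oy; exact: open_nbhs_nbhs.
split.
  apply: (@filterS _ _ _ (fun t : R => Omega (x + t *: v))); last first.
    exact/near_line/nO.
  move=> t Ot; apply/is_derive_line/is_derive_partials => i.
    by apply: filterS (nO _ Ot) => y /fC2[_ /(_ i)[]].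
  by have [_ /(_ i)[]] := fC2 _ Ot.
apply: (@is_derive_line _ _ (fun y => \sum_j v 0 j * partial j f y)).
rewrite scale0r addr0.
have -> : (fun y => \sum_j v 0 j * partial j f y) =
    \sum_j (v 0 j \*: partial j f) :> ('rV[R]_N -> R).
  by apply/funext => y; rewrite fct_sumE.
have D j : is_derive x v (v 0 j \*: partial j f)
    (v 0 j *: \sum_i v 0 i * partial i (partial j f) x).
  apply: is_deriveZ; apply: is_derive_partials => i.
    by apply: filterS (nO _ Ox) => y /fC2[_ _ /(_ i j)[]].
  by have [_ _ /(_ i j)[]] := fC2 _ Ox.
apply: is_derive_eq; rewrite /qform exchange_big/=; apply: eq_bigr => j _.
rewrite [_ *: _]mulr_sumr; apply: eq_bigr => i _.
by rewrite mxE mulrA (mulrC (v 0 j)).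
Qed.

(** On the line through [x] in the direction [v], [phi - psi] has a local maximum at [x], so its
    second derivative there is at most 0. *)
Lemma qform_hessian_le Omega (phi psi : 'rV[R]_N -> R) x v :
  open Omega -> Omega x -> C2_on Omega phi -> C2_on Omega psi ->
  (\forall y \near x, phi y - psi y <= phi x - psi x) ->
  qform (hessian phi x) v <= qform (hessian psi x) v.
Proof.
move=> oO Ox phiC2 psiC2 le_near; rewrite -subr_le0.
have [D1 D2] := C2_line v oO phiC2 Ox; have [D3 D4] := C2_line v oO psiC2 Ox.
apply: (@second_order_max R (fun t => phi (x + t *: v) - psi (x + t *: v))
  (fun t => \sum_j v 0 j * partial j phi (x + t *: v) -
            \sum_j v 0 j * partial j psi (x + t *: v)) 0).
- by near=> t; apply: is_deriveB; near: t.
- by rewrite scale0r addr0; exact: (near_line v le_near).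
Unshelve. all: by end_near. Qed.

Lemma is_derive_translate f y w e (c : R) :
  is_derive (y + w) e f c -> is_derive y e (fun z => f (z + w)) c.
Proof.
move=> /is_deriveP fc; apply/is_deriveP => eps /fc[d d0 dP].
by exists d => // h h0 hd; rewrite addrAC; exact: dP.
Qed.

(** The mean value theorem is used twice: along the direction [i] for [G y = f (y + h e_j) - f y],
    then along the direction [j] for [partial i f]. The second difference is thus [h ^+ 2] times a
    mixed derivative at a point near [x]. *)
Lemma C2_second_difference Omega f x i j : open Omega -> C2_on Omega f ->
  Omega x -> forall eps, 0 < eps ->
  exists2 d, 0 < d & forall h : R, 0 < h < d ->
  `|f (x + h *: delta_mx 0 i + h *: delta_mx 0 j) - f (x + h *: delta_mx 0 i)
    - f (x + h *: delta_mx 0 j) + f x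
    - h ^+ 2 * partial j (partial i f) x| <= eps * h ^+ 2.
Proof.
move=> oO fC2 Ox eps eps0.
have nO : \forall y \near x, Omega y by exact: open_nbhs_nbhs.
have [_ _ /(_ j i)[_ /cvgrPdist_le cont]] := fC2 _ Ox.
have /nbhs_distP[d0 d00 dP] : \forall y \near x,
    Omega y /\ `|partial j (partial i f) x - partial j (partial i f) y| <= eps.
  by apply: filterS2 nO (cont _ eps0) => y.
pose M : R := `|delta_mx 0 i : 'rV[R]_N| + `|delta_mx 0 j : 'rV[R]_N| + 1.
have M0 : 0 < M by rewrite ltr_wpDl// addr_ge0.
exists (d0 / M); first by rewrite divr_gt0.
move=> h /andP[h0]; rewrite ltr_pdivlMr// => hM.
have nearx (t t' : R) : `|t| <= `|h| -> `|t'| <= `|h| ->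
    `|x + t *: delta_mx 0 i + t' *: delta_mx 0 j - x| < d0.
  move=> th t'h; rewrite -[x + _ + _]addrA [x + _]addrC addrK.
  rewrite (le_lt_trans _ hM)// (le_trans (ler_normD _ _))// !normrZ /M.
  rewrite -[h in leRHS]gtr0_norm// 2!mulrDr mulr1.
  by rewrite -[leLHS]addr0 !lerD// ler_wpM2r.
have inO (t t' : R) : `|t| <= `|h| -> `|t'| <= `|h| ->
    Omega (x + t *: delta_mx 0 i + t' *: delta_mx 0 j).
  by move=> th t'h; have [] := dP _ (nearx _ _ th t'h).
have inO0 (t : R) : `|t| <= `|h| -> Omega (x + t *: delta_mx 0 i).
  move=> th; have := inO t 0 th; rewrite scale0r addr0; apply.
  by rewrite normr0.
pose G y := f (y + h *: delta_mx 0 j) - f y.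
have dG (t : R) : `|t| <= `|h| ->
    is_derive (x + t *: delta_mx 0 i) (delta_mx 0 i) G
      (partial i f (x + t *: delta_mx 0 i + h *: delta_mx 0 j) -
       partial i f (x + t *: delta_mx 0 i)).
  move=> th; apply: is_deriveB.
    apply: is_derive_translate; apply: derivableP.
    by have [_ /(_ i)[]] := fC2 _ (inO t h th (lexx _)).
  by apply: derivableP; have [_ /(_ i)[]] := fC2 _ (inO0 t th).
have [t th Et] := @MVT_line _ _ G x (delta_mx 0 i) h
  (fun t th => @ex_derive _ _ _ _ _ _ _ (dG t th)).
have dfi (t' : R) : `|t'| <= `|h| -> derivable (partial i f)
    (x + t *: delta_mx 0 i + t' *: delta_mx 0 j) (delta_mx 0 j).
  by move=> t'h; have [_ _ /(_ j i)[]] := fC2 _ (inO t t' th t'h).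
have [t' t'h Et'] := @MVT_line _ _ (partial i f) (x + t *: delta_mx 0 i)
  (delta_mx 0 j) h dfi.
have [_ close] := dP _ (nearx t t' th t'h).
have [_ dGE] := dG t th; move: Et; rewrite dGE Et' /G => Et.
have -> : f (x + h *: delta_mx 0 i + h *: delta_mx 0 j) -
    f (x + h *: delta_mx 0 i) - f (x + h *: delta_mx 0 j) + f x =
    h * (h * 'D_(delta_mx 0 j) (partial i f)
      (x + t *: delta_mx 0 i + t' *: delta_mx 0 j)).
  by rewrite -Et; ring.
rewrite mulrA -expr2 -mulrBr normrM mulrC distrC ger0_norm ?sqr_ge0//.
by rewrite ler_wpM2r ?sqr_ge0.
Qed.


(** The second difference is symmetric in [i] and [j], and divided by [h ^+ 2] it approximates both
    mixed derivatives. *)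
Lemma hessian_sym Omega f x : open Omega -> C2_on Omega f -> Omega x ->
  (hessian f x)^T = hessian f x.
Proof.
move=> oO fC2 Ox; apply/matrixP => i j; rewrite !mxE.
have aux (s u v k : R) : `|s - u| <= k -> `|s - v| <= k -> `|u - v| <= k + k.
  rewrite !ler_norml => /andP[? ?] /andP[? ?]; apply/andP; split; lra.
apply/eqP; rewrite -subr_eq0 -normr_le0; apply/ler_addgt0Pr => eps eps0.
rewrite add0r.
have e2 : 0 < eps / 2 by rewrite divr_gt0.
have [d d0 dP] := C2_second_difference i j oO fC2 Ox e2.
have [d' d'0 dP'] := C2_second_difference j i oO fC2 Ox e2.
have [h [h0 hd hd']] : exists h : R, [/\ 0 < h, h < d & h < d'].
  exists (Num.min d d' / 2); have m0 : 0 < Num.min d d' by rewrite lt_min d0.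
  have : Num.min d d' / 2 < Num.min d d'.
    by rewrite ltr_pdivrMr// ltr_pMr// ltr1n.
  by rewrite lt_min => /andP[? ?]; rewrite divr_gt0.
have := dP h; rewrite h0 hd => /(_ isT) H1.
have := dP' h; rewrite h0 hd' => /(_ isT) H2.
have h2 : 0 < h ^+ 2 by rewrite exprn_gt0.
rewrite (addrAC x) [f _ - _ - _]addrAC in H2.
have := aux _ _ _ _ H1 H2.
rewrite -mulrBr normrM gtr0_norm// -mulrDl -splitr mulrC.
by rewrite ler_pM2r.
Qed.
End Multi.

(** * Rayleigh quotients of symmetric matrices *)

Lemma continuous_sum (R : realType) (T : topologicalType) (I : Type)
    (r : seq I) (F : I -> T -> R) :
  (forall i, continuous (F i)) -> continuous (fun x => \sum_(i <- r) F i x).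
Proof.
move=> cF; elim: r => [|i r IH] x.
  by under eq_fun do rewrite big_nil; exact: cvg_cst.
by under eq_fun do rewrite big_cons; apply: cvgD; [exact: cF|exact: IH].
Qed.

Lemma continuous_add (R : realType) (T : topologicalType) (f g : T -> R) :
  continuous f -> continuous g -> continuous (fun x => f x + g x).
Proof. by move=> cf cg x; apply: cvgD; [exact: cf|exact: cg]. Qed.

Lemma continuous_mul (R : realType) (T : topologicalType) (f g : T -> R) :
  continuous f -> continuous g -> continuous (fun x => f x * g x).
Proof. by move=> cf cg x; apply: cvgM; [exact: cf|exact: cg]. Qed.

Section Rayleigh.
Variables (R : realType) (N : nat).
Implicit Types (H : 'M[R]_N) (v w : 'rV[R]_N).

(** The squared Euclidean norm, whereas the norm of row vectors is the maximum norm. *)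
Definition nsq v : R := \sum_i v 0 i ^+ 2.

Lemma nsq_ge0 v : 0 <= nsq v.
Proof. by apply: sumr_ge0 => i _; rewrite sqr_ge0. Qed.

Lemma nsq_eq0 v : nsq v = 0 -> v = 0.
Proof.
move=> /eqP; rewrite psumr_eq0 => [/allP v0|i _]; last by rewrite sqr_ge0.
apply/rowP => i; rewrite mxE; apply/eqP.
by have := v0 i (mem_index_enum _); rewrite sqrf_eq0.
Qed.

Lemma nsqZ (a : R) v : nsq (a *: v) = a ^+ 2 * nsq v.
Proof. by rewrite mulr_sumr; apply: eq_bigr => i _; rewrite mxE exprMn. Qed.

Lemma nsqE v : nsq v = (v *m v^T) 0 0.
Proof. by rewrite mxE; apply: eq_bigr => i _; rewrite mxE expr2. Qed.

Lemma qformE H v : qform H v = (v *m H *m v^T) 0 0.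
Proof.
rewrite mxE /qform exchange_big/=; apply: eq_bigr => j _.
rewrite !mxE mulr_suml; apply: eq_bigr => i _; ring.
Qed.

Lemma qformZ H (a : R) v : qform H (a *: v) = a ^+ 2 * qform H v.
Proof.
rewrite mulr_sumr; apply: eq_bigr => i _; rewrite mulr_sumr.
by apply: eq_bigr => j _; rewrite !mxE; ring.
Qed.

Lemma nsqD v w (t : R) :
  nsq (v + t *: w) = nsq v + 2 * t * (v *m w^T) 0 0 + t ^+ 2 * nsq w.
Proof.
have ED (A B : 'M[R]_1) : (A + B) 0 0 = A 0 0 + B 0 0 by rewrite mxE.
have EZ a (A : 'M[R]_1) : (a *: A) 0 0 = a * A 0 0 by rewrite mxE.
have sym : (w *m v^T) 0 0 = (v *m w^T) 0 0.
  by rewrite -[w *m v^T]trmxK trmx_mul trmxK mxE.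
rewrite !nsqE linearD linearZ/= mulmxDl !mulmxDr -!scalemxAl -!scalemxAr.
by rewrite !(ED, EZ) sym; ring.
Qed.

Lemma qformD H v w (t : R) : H^T = H ->
  qform H (v + t *: w) =
  qform H v + 2 * t * (v *m H *m w^T) 0 0 + t ^+ 2 * qform H w.
Proof.
move=> Hsym.
have ED (A B : 'M[R]_1) : (A + B) 0 0 = A 0 0 + B 0 0 by rewrite mxE.
have EZ a (A : 'M[R]_1) : (a *: A) 0 0 = a * A 0 0 by rewrite mxE.
have sym : (w *m H *m v^T) 0 0 = (v *m H *m w^T) 0 0.
  transitivity ((w *m H *m v^T)^T 0 0); first by rewrite [RHS]mxE.
  by rewrite !trmx_mul trmxK Hsym mulmxA.
rewrite !qformE linearD linearZ/= !mulmxDl !mulmxDr -!scalemxAl -!scalemxAr.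
by rewrite !(ED, EZ) sym; ring.
Qed.

Lemma qform_continuous H : continuous (qform H).
Proof.
apply: (@continuous_sum R _ _ _ (fun i v => \sum_j v 0 i * v 0 j * H i j)) => i.
apply: (@continuous_sum R _ _ _ (fun j v => v 0 i * v 0 j * H i j)) => j.
apply: continuous_mul; last exact: cst_continuous.
by apply: continuous_mul; exact: coord_continuous.
Qed.

Lemma nsq_continuous : continuous nsq.
Proof.
apply: (@continuous_sum R _ _ _ (fun i v => v 0 i ^+ 2)) => i.
by apply: continuous_mul; exact: coord_continuous.
Qed.

Lemma sphere_compact : compact [set v | nsq v = 1].
Proof.
apply: (@subclosed_compact _ _
  [set v : 'rV[R]_N | forall i, `[-1, 1]%classic (v ord0 i)]).
- apply: (@preimage_closed _ _ nsq [set 1]) => [v _|].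
    exact: nsq_continuous.
  exact: closed_eq.
- by apply: (@rV_compact R N (fun=> `[-1, 1]%classic)) => i;
    exact: segment_compact.
- move=> v /= v1 i; rewrite in_itv/= -ler_norml -(@expr_le1 _ 2)//.
  rewrite real_normK ?num_real// -v1 /nsq (bigD1 i)//= lerDl.
  by apply: sumr_ge0 => j _; rewrite sqr_ge0.
Qed.

(** The form attains its maximum on the compact unit sphere; homogeneity of degree 2 extends the
    bound to all vectors. *)
Lemma qform_sphere_max H : (0 < N)%N -> exists2 c, nsq c = 1 &
  forall v, qform H v <= qform H c * nsq v.
Proof.
move=> N0; have S0 : [set v | nsq v = 1] !=set0.
  exists (delta_mx 0 (Ordinal N0)); rewrite /= /nsq (bigD1 (Ordinal N0))//=.
  rewrite mxE !eqxx expr1n big1 ?addr0// => i iN.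
  by rewrite mxE (negbTE iN) andbF expr0n.
have [c] := @EVT_max_rV R N (qform H) _ S0 sphere_compact
  (continuous_subspaceT (@qform_continuous H)).
rewrite inE/= => c1 cmax; exists c => // v.
have [/nsq_eq0 ->|v0] := eqVneq (nsq v) 0.
  by rewrite -(scale0r 0) qformZ nsqZ expr0n/= !mul0r mulr0.
have v_gt0 : 0 < nsq v by rewrite lt_def v0 nsq_ge0.
have s2 : Num.sqrt (nsq v) ^+ 2 = nsq v by rewrite sqr_sqrtr// ltW.
have := cmax ((Num.sqrt (nsq v))^-1 *: v).
rewrite inE/= nsqZ qformZ exprVn s2 mulVf// => /(_ erefl).
by rewrite ler_pdivrMl// mulrC.
Qed.

Lemma symmetric_max_eigenvector H : (0 < N)%N -> H^T = H ->
  exists2 c, nsq c = 1 & c *m H = qform H c *: c /\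
  forall v, qform H v <= qform H c * nsq v.
Proof.
move=> N0 Hsym; have [c c1 cmax] := qform_sphere_max H N0.
exists c => //; split=> //.
pose M := qform H c.
pose w := M *: c - c *m H.
suff /nsq_eq0/eqP : nsq w = 0 by rewrite subr_eq0 => /eqP ->.
(* The form M|v|^2 - qform H v is nonnegative and vanishes at c; along the line
   through c in the direction w its linear term is 2 |w|^2. *)
have key (t : R) : 0 <= 2 * t * nsq w + t ^+ 2 * (M * nsq w - qform H w).
  have := cmax (c + t *: w); rewrite -subr_ge0 -/M.
  suff -> : M * nsq (c + t *: w) - qform H (c + t *: w) =
      2 * t * nsq w + t ^+ 2 * (M * nsq w - qform H w) by [].
  rewrite nsqD qformD// c1 -/M.
  have : nsq w = M * (c *m w^T) 0 0 - (c *m H *m w^T) 0 0.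
    by rewrite nsqE {1}/w mulmxBl -scalemxAl !mxE.
  by move=> Ew; rewrite Ew; ring.
set b := M * _ - _ in key.
have w0 := nsq_ge0 w.
have b0 : 0 <= b by rewrite subr_ge0; exact: cmax.
have b1 : 0 < b + 1 by rewrite ltr_wpDl.
(* A negative [t] small enough for the linear term to win; the [+ 1] avoids a division by 0. The
   value is [- nsq w ^+ 2] times a positive factor, which forces [nsq w = 0]. *)
have := key (- nsq w / (b + 1)).
have -> : 2 * (- nsq w / (b + 1)) * nsq w + (- nsq w / (b + 1)) ^+ 2 * b =
    - (nsq w ^+ 2 * ((b + 2) / (b + 1) ^+ 2)) by field; rewrite gt_eqF.
rewrite oppr_ge0 pmulr_lle0 => [h|]; last first.
  by rewrite divr_gt0 ?exprn_gt0// ltr_wpDl.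
by apply/eqP; rewrite -sqrf_eq0 eq_le h sqr_ge0.
Qed.

(** The maximum of the form on the unit sphere is an eigenvalue, and it bounds every eigenvalue, as
    evaluating the form at an eigenvector shows. So it is the supremum that defines
    [largest_eigenvalue]. *)
Lemma largest_eigenvalue_sym H : (0 < N)%N -> H^T = H ->
  exists2 c, nsq c = 1 & qform H c = largest_eigenvalue H /\
  forall v, qform H v <= largest_eigenvalue H * nsq v.
Proof.
move=> N0 Hsym; have [c c1 [cH cmax]] := symmetric_max_eigenvector N0 Hsym.
suff <- : qform H c = largest_eigenvalue H by exists c.
have ub : ubound [set a : R | eigenvalue H a] (qform H c).
  move=> a /= /eigenvalueP[v vH v0].
  have nv0 : 0 < nsq v.
    by rewrite lt_def nsq_ge0 andbT; apply: contra_neq v0; exact: nsq_eq0.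
  have := cmax v; rewrite [in leLHS]qformE vH -scalemxAl mxE -nsqE.
  by rewrite ler_pM2r.
have ev : eigenvalue H (qform H c).
  apply/eigenvalueP; exists c => //; apply/eqP => c0.
  have := oner_neq0 R; rewrite -c1 c0 -(scale0r 0) nsqZ expr0n/= mul0r.
  by rewrite eqxx.
apply/eqP; rewrite eq_le; apply/andP; split.
  by apply: ub_le_sup => //; exists (qform H c).
by apply: ge_sup => //; exists (qform H c).
Qed.

Lemma largest_eigenvalue_le H (a : R) : (0 < N)%N -> H^T = H ->
  (forall v, qform H v <= a * nsq v) -> largest_eigenvalue H <= a.
Proof.
move=> N0 Hsym Ha; have [c c1 [<- _]] := largest_eigenvalue_sym N0 Hsym.
by have := Ha c; rewrite c1 mulr1.
Qed.

Lemma largest_eigenvalue_ge H (a : R) v : (0 < N)%N -> H^T = H -> v != 0 ->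
  a * nsq v <= qform H v -> a <= largest_eigenvalue H.
Proof.
move=> N0 Hsym v0 av; have [c _ [_ cmax]] := largest_eigenvalue_sym N0 Hsym.
have := le_trans av (cmax v); rewrite ler_pM2r// lt_def nsq_ge0 andbT.
by apply: contra_neq v0; exact: nsq_eq0.
Qed.
End Rayleigh.

(** * Exponentials of quadratic polynomials *)

Lemma is_derive_of_line (R : realType) (V : normedModType R) (f : V -> R)
    (y e : V) (c : R) :
  is_derive (0 : R) 1 (fun s : R => f (y + s *: e)) c -> is_derive y e f c.
Proof.
move=> /is_deriveP fc; apply/is_deriveP => eps /fc[d d0 dP].
exists d => // h h0 hd; have := dP h h0 hd.
by rewrite scale0r addr0 add0r [_%:A]mulr1.
Qed.

Section ExpQuad.
Variables (R : realType) (N : nat) (k : R) (a : 'rV[R]_N) (l m : 'I_N -> R).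
Implicit Types (x y : 'rV[R]_N).

(** The logarithm is given by its Taylor expansion at [a]: value [k], gradient [l], Hessian
    [diag (2 m)]. *)
Definition expquad x : R :=
  expR (k + \sum_i (l i * (x 0 i - a 0 i) + m i * (x 0 i - a 0 i) ^+ 2)).

Definition expquad_slope i x : R := l i + 2 * m i * (x 0 i - a 0 i).

Lemma expquad_center : expquad a = expR k.
Proof.
rewrite /expquad big1 ?addr0// => i _.
by rewrite subrr mulr0 expr0n mulr0 addr0.
Qed.

Lemma slope_center i : expquad_slope i a = l i.
Proof. by rewrite /expquad_slope subrr mulr0 addr0. Qed.

Lemma expquad_continuous : continuous expquad.
Proof.
move=> x; apply: continuous_comp; last exact: continuous_expR.
move: x; apply: (@continuous_add R _ (fun=> k)); first exact: cst_continuous.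
apply: (@continuous_sum R _ _ _ (fun i x => _)) => i.
have c : continuous (fun x => x 0 i - a 0 i).
  by apply: continuous_add; [exact: coord_continuous|exact: cst_continuous].
apply: continuous_add; apply: continuous_mul => //; try exact: cst_continuous.
exact: continuous_mul.
Qed.

Lemma slope_continuous i : continuous (expquad_slope i).
Proof.
apply: continuous_add; first exact: cst_continuous.
apply: continuous_mul; first exact: cst_continuous.
by apply: continuous_add; [exact: coord_continuous|exact: cst_continuous].
Qed.

Lemma is_derive_expquad x j :
  is_derive x (delta_mx 0 j) expquad (expquad x * expquad_slope j x).
Proof.
apply: is_derive_of_line; rewrite /expquad.
set E := k + _.
rewrite (_ : (fun s : R => _) = fun s : R => expR
    (E + (l j * s + m j * (2 * (x 0 j - a 0 j) * s + s ^+ 2)))); last first.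
  apply/funext => s; congr expR; rewrite /E -addrA; congr (_ + _).
  rewrite (bigD1 j)//= [in RHS](bigD1 j)//= !mxE !eqxx mulr1.
  rewrite (eq_bigr (fun i => l i * (x 0 i - a 0 i) +
      m i * (x 0 i - a 0 i) ^+ 2)).
    by ring.
  by move=> i ij; rewrite !mxE (negbTE ij) andbF mulr0 addr0.
apply: is_derive_eq; rewrite /GRing.scale/= /expquad_slope.
rewrite [_ + (l j * 0 + _)](_ : _ = E); last by ring.
ring.
Qed.

Lemma is_derive_slope x i j :
  is_derive x (delta_mx 0 i) (expquad_slope j) (2 * m j * (j == i)%:R).
Proof.
apply: is_derive_of_line.
rewrite (_ : (fun s : R => _) = fun s : R =>
    expquad_slope j x + 2 * m j * (j == i)%:R * s); last first.
  by apply/funext => s; rewrite /expquad_slope !mxE eqxx/=; ring.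
by apply: is_derive_eq; rewrite /GRing.scale/=; ring.
Qed.

Lemma partial_expquad j :
  partial j expquad = fun x => expquad x * expquad_slope j x.
Proof. by apply/funext => x; have [_ <-] := is_derive_expquad x j. Qed.

Lemma is_derive_partial_expquad x i j :
  is_derive x (delta_mx 0 i) (partial j expquad)
   (expquad x * (expquad_slope i x * expquad_slope j x + 2 * m j * (j == i)%:R)).
Proof.
rewrite partial_expquad.
have D1 := is_derive_expquad x i; have D2 := is_derive_slope x i j.
apply: (@is_derive_eq _ _ _ _ _ _ _ _ (is_deriveM D1 D2)).
by rewrite /GRing.scale/=; ring.
Qed.

Lemma expquad_C2 (Omega : set 'rV[R]_N) : C2_on Omega expquad.
Proof.
move=> x Ox; split=> [|i|i j].
- exact: expquad_continuous.
- split; first by have [] := is_derive_expquad x i.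
  rewrite partial_expquad; apply: continuous_mul.
    exact: expquad_continuous.
  exact: slope_continuous.
- split; first by have [] := is_derive_partial_expquad x i j.
  rewrite (_ : partial i _ = fun x => expquad x *
    (expquad_slope i x * expquad_slope j x + 2 * m j * (j == i)%:R)); last first.
    by apply/funext => z; have [_ <-] := is_derive_partial_expquad z i j.
  apply: continuous_mul; first exact: expquad_continuous.
  apply: continuous_add; last exact: cst_continuous.
  by apply: continuous_mul; exact: slope_continuous.
Qed.

(** The Hessian of [exp g] is [exp g] times the sum of the Hessian of [g] and the square of its
    gradient. *)
Lemma qform_hessian_expquad v : qform (hessian expquad a) v =
  expR k * ((\sum_i l i * v 0 i) ^+ 2 + \sum_i 2 * m i * v 0 i ^+ 2).
Proof.
rewrite /qform mulrDr expr2 big_distrlr/= !mulr_sumr -big_split/=.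
apply: eq_bigr => i _.
rewrite (eq_bigr (fun j => expR k * (l i * v 0 i * (l j * v 0 j)) +
   expR k * (2 * m j * v 0 i * v 0 j * (j == i)%:R))); last first.
  move=> j _; have [_ dE] := is_derive_partial_expquad a i j.
  by rewrite mxE {1}/partial dE expquad_center !slope_center; ring.
rewrite big_split/= mulr_sumr; congr (_ + _).
rewrite (bigD1 i)//= big1 ?eqxx/= => [|j /negbTE ->].
  by rewrite mulr1; ring.
by rewrite !mulr0.
Qed.
End ExpQuad.

(** * Products of powers of cosines *)

Lemma near_cos_gt0 (R : realType) (b x : R) : 0 < cos (b * x) ->
  \forall y \near x, 0 < cos (b * y).
Proof.
move=> cx; have c : continuous (fun y : R => cos (b * y)).
  move=> y; apply: continuous_comp; last exact: continuous_cos.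
  by apply: mulrl_continuous.
exact: (cvgr_gt _ (c x)).
Qed.

Lemma is_derive_lncos (R : realType) (e b y : R) : 0 < cos (b * y) ->
  is_derive y 1 (fun s : R => e * ln (cos (b * s))) (- (e * b * tan (b * y))).
Proof.
move=> cy.
have D1 : is_derive y 1 (fun s : R => b * s) b.
  by apply: is_derive_eq; rewrite /GRing.scale/=; ring.
have D2 := is_derive1_comp (is_derive_cos (b * y)) D1.
have D3 := is_derive1_comp (is_derive1_ln cy) D2.
have D4 := is_deriveZ e D3.
apply: (@is_derive_eq _ _ _ _ _ _ _ _ D4).
by rewrite /GRing.scale/= /tan; field; rewrite gt_eqF.
Qed.

Lemma is_derive_tan_scale (R : realType) (e b y : R) : 0 < cos (b * y) ->
  is_derive y 1 (fun s : R => - (e * b * tan (b * s)))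
    (- (e * b ^+ 2 * (1 + tan (b * y) ^+ 2))).
Proof.
move=> cy; have cy0 : cos (b * y) != 0 by rewrite gt_eqF.
have D1 : is_derive y 1 (fun s : R => b * s) b.
  by apply: is_derive_eq; rewrite /GRing.scale/=; ring.
have D2 := is_derive1_comp (is_derive_tan cy0) D1.
have D4 := is_deriveN (is_deriveZ (e * b) D2).
apply: (@is_derive_eq _ _ _ _ _ _ _ _ D4).
by rewrite cos2_tan2// /GRing.scale/=; ring.
Qed.

(** The slack [eps] provides the strict inequality on second derivatives that [taylor2_le] requires.
    The sign of [e] is free, so that [- e] yields the bound from above. *)
Lemma lncos_taylor2_le (R : realType) (e b x eps : R) :
  0 < cos (b * x) -> 0 < eps -> \forall y \near x,
  e * ln (cos (b * x)) + - (e * b * tan (b * x)) * (y - x) +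
    (- eps - e * b ^+ 2 * (1 + tan (b * x) ^+ 2)) / 2 * (y - x) ^+ 2
  <= e * ln (cos (b * y)).
Proof.
move=> cx eps0.
apply: (@taylor2_le R (fun s => e * ln (cos (b * s)))
  (fun s => - (e * b * tan (b * s))) x _ _ _ (is_derive_tan_scale e cx)).
  by apply: filterS (near_cos_gt0 cx) => y; exact: is_derive_lncos.
by rewrite -[_ *+ 2]mulr_natr divfK ?pnatr_eq0// ltrBlDr addrC subrr oppr_lt0.
Qed.

Section CosProduct.
Variables (R : realType) (N : nat) (b e : 'I_N -> R).
Implicit Types (x y : 'rV[R]_N).

Definition cosprod x : R := \prod_i cos (b i * x 0 i) `^ e i.

Definition cosbox : set 'rV[R]_N :=
  [set x | forall i, - (pi / 2) < b i * x 0 i < pi / 2].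

Lemma cosbox_gt0 x i : cosbox x -> 0 < cos (b i * x 0 i).
Proof. by move=> /(_ i); exact: cos_gt0_pihalf. Qed.

(** Its logarithm is the second-order expansion of [ln (cosprod y)] at [x], with [eps] added to the
    pure second derivatives and the value at [x] replaced by [k]. The free [k] allows a multiple of
    the comparison function to touch another function at [x]. *)
Definition cosjet (k eps : R) x : 'rV[R]_N -> R :=
  expquad k x (fun i => - (e i * b i * tan (b i * x 0 i)))
    (fun i => (eps - e i * b i ^+ 2 * (1 + tan (b i * x 0 i) ^+ 2)) / 2).

Lemma cosprod_expR x : (forall i, 0 < cos (b i * x 0 i)) ->
  cosprod x = expR (\sum_i e i * ln (cos (b i * x 0 i))).
Proof.
move=> cx; rewrite expR_sum; apply: eq_bigr => i _.
by rewrite /powR gt_eqF.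
Qed.

Lemma near_coord x (P : 'I_N -> set R) :
  (forall i, \forall s \near x 0 i, P i s) ->
  \forall y \near x, forall i, P i ((y : 'rV[R]_N) 0 i).
Proof.
move=> xP.
apply: (@filter_forall _ _ (fun i (y : 'rV[R]_N) => P i (y 0 i)) (nbhs x) _).
by move=> i; exact: (@coord_continuous R 1 N 0 i x _ (xP i)).
Qed.

Lemma cosjet_le x (eps : R) : cosbox x -> 0 < eps -> \forall y \near x,
  cosjet (ln (cosprod x)) (- eps) x y <= cosprod y.
Proof.
move=> bx eps0; have cx i := cosbox_gt0 i bx.
have := near_coord (fun i => lncos_taylor2_le (e i) (cx i) eps0).
have := near_coord (fun i => near_cos_gt0 (cx i)).
apply: filterS2 => y cy ley; rewrite !cosprod_expR// expRK /cosjet /expquad.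
rewrite ler_expR -big_split; apply: ler_sum => i _ /=.
by rewrite addrA; exact: ley.
Qed.

Lemma cosjet_ge x (eps : R) : cosbox x -> 0 < eps -> \forall y \near x,
  cosprod y <= cosjet (ln (cosprod x)) eps x y.
Proof.
move=> bx eps0; have cx i := cosbox_gt0 i bx.
(* With the opposite weights the lower Taylor bound becomes an upper one. *)
have := near_coord (fun i => lncos_taylor2_le (- e i) (cx i) eps0).
have := near_coord (fun i => near_cos_gt0 (cx i)).
apply: filterS2 => y cy ley; rewrite !cosprod_expR// expRK /cosjet /expquad.
rewrite ler_expR -big_split; apply: ler_sum => i _ /=.
have h := ley i; rewrite -subr_ge0 in h; rewrite -subr_ge0; apply: (le_trans h).
by rewrite le_eqVlt; apply/orP; left; apply/eqP; field.
Qed.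

Variable mu : R.
Hypotheses (b0 : forall i, 0 < b i) (mu0 : 0 < mu).
Hypotheses (eb : forall i, e i * b i ^+ 2 = mu) (e1 : \sum_i e i = 1).

Lemma weight_gt0 i : 0 < e i.
Proof. by move: mu0; rewrite -(eb i) pmulr_lgt0// exprn_gt0. Qed.

(** The difference of the two sides is the variance of [z] for the weights [e]. *)
Lemma sqr_average_le (z : 'I_N -> R) :
  (\sum_i e i * z i) ^+ 2 <= \sum_i e i * z i ^+ 2.
Proof.
set s := \sum_i _; rewrite -subr_ge0.
have -> : \sum_i e i * z i ^+ 2 - s ^+ 2 = \sum_i e i * (z i - s) ^+ 2.
  rewrite [RHS](eq_bigr (fun i => e i * z i ^+ 2 +
      (- (2 * s) * (e i * z i) + s ^+ 2 * e i))).
    by rewrite 2!big_split/= -!mulr_sumr e1 -/s; ring.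
  by move=> i _; ring.
by apply: sumr_ge0 => i _; rewrite mulr_ge0 ?sqr_ge0// ltW// weight_gt0.
Qed.

(** Since [e i * b i ^+ 2] is the same [mu] for all [i], the part of the Hessian without tangents is
    a multiple of the identity. What remains is minus a weighted variance. *)
Lemma qform_cosjet k eps x v :
  qform (hessian (cosjet k eps x) x) v = expR k * ((eps - mu) * nsq v +
   ((\sum_i e i * (b i * tan (b i * x 0 i) * v 0 i)) ^+ 2 -
     \sum_i e i * (b i * tan (b i * x 0 i) * v 0 i) ^+ 2)).
Proof.
rewrite qform_hessian_expquad; congr (_ * _).
rewrite (eq_bigr (fun i => - (e i * (b i * tan (b i * x 0 i) * v 0 i))));
  last first.
  by move=> i _; ring.
rewrite sumrN sqrrN.
rewrite [X in _ + X](eq_bigr (fun i => (eps - mu) * v 0 i ^+ 2 -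
   e i * (b i * tan (b i * x 0 i) * v 0 i) ^+ 2)); last first.
  by move=> i _; rewrite -(eb i); field.
by rewrite big_split/= sumrN -mulr_sumr /nsq; ring.
Qed.

Lemma largest_eigenvalue_cosjet k eps x : (0 < N)%N ->
  largest_eigenvalue (hessian (cosjet k eps x) x) = (eps - mu) * expR k.
Proof.
move=> N0.
have Hsym : (hessian (cosjet k eps x) x)^T = hessian (cosjet k eps x) x.
  by apply: (@hessian_sym _ _ setT) => //; [exact: openT|exact: expquad_C2].
apply/eqP; rewrite eq_le; apply/andP; split.
  apply: largest_eigenvalue_le => // v.
  rewrite qform_cosjet [X in _ <= X * _]mulrC -mulrA ler_pM2l ?expR_gt0//.
  by rewrite gerDl subr_le0 sqr_average_le.
have e0 i : e i != 0 by rewrite gt_eqF// weight_gt0.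
have bn0 i : b i != 0 by rewrite gt_eqF.
(* The variance vanishes if [b i * tan (b i * x 0 i) * v 0 i] does not depend on [i]. If some
   tangent is 0, a coordinate vector makes all these numbers 0; otherwise the vector of reciprocals
   makes them all 1. *)
have [v v0 vE] : exists2 v : 'rV[R]_N, v != 0 &
    (\sum_i e i * (b i * tan (b i * x 0 i) * v 0 i)) ^+ 2 =
     \sum_i e i * (b i * tan (b i * x 0 i) * v 0 i) ^+ 2.
  have [[j tj]|nt] := pselect (exists j, tan (b j * x 0 j) = 0).
    exists (delta_mx 0 j).
      by apply/eqP => /rowP/(_ j)/eqP; rewrite !mxE !eqxx oner_eq0.
    have z i : b i * tan (b i * x 0 i) * (delta_mx 0 j : 'rV[R]_N) 0 i = 0.
      rewrite mxE; have [->|_] := eqVneq i j;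
        by rewrite ?tj ?andbF /= ?mulr0 ?mul0r.
    by rewrite !big1 ?expr0n// => i _; rewrite z ?expr0n mulr0.
  have t0 i : b i * tan (b i * x 0 i) != 0.
    by rewrite mulf_neq0//; apply/eqP => ti; apply: nt; exists i.
  exists (\row_i (b i * tan (b i * x 0 i))^-1).
    apply/eqP => /rowP/(_ (Ordinal N0))/eqP; rewrite !mxE invr_eq0.
    by rewrite (negbTE (t0 _)).
  rewrite (eq_bigr e) => [|i _]; last by rewrite mxE divff// mulr1.
  rewrite [RHS](eq_bigr e) => [|i _]; last by rewrite mxE divff// expr1n mulr1.
  by rewrite e1 expr1n.
apply: (@largest_eigenvalue_ge _ _ _ _ v) => //.
by rewrite qform_cosjet vE subrr addr0 mulrAC mulrC.
Qed.
End CosProduct.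

(** * Continuity and boundary values of the cosine product *)

Lemma continuous_prod (R : realType) (T : topologicalType) (I : Type)
    (r : seq I) (F : I -> T -> R) :
  (forall i, continuous (F i)) -> continuous (fun x => \prod_(i <- r) F i x).
Proof.
move=> cF; elim: r => [|i r IH] x.
  by under eq_fun do rewrite big_nil; exact: cvg_cst.
by under eq_fun do rewrite big_cons; apply: cvgM; [exact: cF|exact: IH].
Qed.

Lemma continuous_norm_powR (R : realType) (p : R) : 0 < p ->
  continuous (fun s : R => `|s| `^ p).
Proof.
move=> p0 s; have [->|s0] := eqVneq s 0.
  apply/cvgrPdist_lt => eps eps0; apply/(nbhs_distP (0 : R)).
  exists (eps `^ p^-1); first exact: powR_gt0.
  move=> y; rewrite subr0 => yd.
  rewrite normr0 powR0 ?gt_eqF// sub0r normrN ger0_norm ?powR_ge0//.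
  have := gt0_ltr_powR p0 _ _ yd; rewrite -powRrM mulVf ?gt_eqF// powRr1 ?ltW//.
  by apply; rewrite nnegrE// powR_ge0.
have ns0 : 0 < `|s| by rewrite normr_gt0.
have c1 : {for `|s|, continuous (fun t : R => t `^ p)}.
  have [d _] := is_derive1_powR p ns0.
  exact/differentiable_continuous/derivable1_diffP.
have c2 : {for s, continuous (fun t : R => `|t|)} by exact: norm_continuous.
exact: (continuous_comp c2 c1).
Qed.

Section CosProductContinuity.
Variables (R : realType) (N : nat) (b e : 'I_N -> R).
Hypothesis e0 : forall i, 0 < e i.
Implicit Types (x y : 'rV[R]_N).

Definition ccosbox : set 'rV[R]_N :=
  [set x | forall i, - (pi / 2) <= b i * x 0 i <= pi / 2].

(* Continuous on the whole space, whereas cosprod jumps where a cosine changes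
   sign, because s `^ p = 1 for s < 0. *)
Definition normcosprod x : R := \prod_i `|cos (b i * x 0 i)| `^ e i.

Lemma coord_scale_continuous i : continuous (fun x : 'rV[R]_N => b i * x 0 i).
Proof.
by apply: continuous_mul; [exact: cst_continuous|exact: coord_continuous].
Qed.

Lemma normcosprod_continuous : continuous normcosprod.
Proof.
apply: (@continuous_prod R _ _ _ (fun i x => `|cos (b i * x 0 i)| `^ e i)) => i.
move=> x; apply: (@continuous_comp _ _ _ (fun x => cos (b i * x 0 i))
    (fun s => `|s| `^ e i)); last exact: continuous_norm_powR.
apply: (@continuous_comp _ _ _ (fun x => b i * x 0 i) cos).
  exact: coord_scale_continuous.
exact: continuous_cos.
Qed.

Lemma normcosprodE x : ccosbox x -> normcosprod x = cosprod b e x.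
Proof.
move=> bx; apply: eq_bigr => i _; rewrite ger0_norm//.
exact: cos_ge0_pihalf (bx i).
Qed.

Lemma cosboxW x : cosbox b x -> ccosbox x.
Proof. by move=> bx i; have /andP[? ?] := bx i; rewrite !ltW. Qed.

Lemma cosbox_open : open (cosbox b).
Proof.
rewrite openE => x bx.
apply: (near_coord (P := fun i s => - (pi / 2) < b i * s < pi / 2)) => i.
have /andP[l u] := bx i.
have c : b i * s @[s --> x 0 i] --> b i * x 0 i by exact: mulrl_continuous.
by near=> s; apply/andP; split; near: s;
  [exact: (cvgr_gt _ c)|exact: (cvgr_lt _ c)].
Unshelve. all: by end_near. Qed.

Lemma closure_cosbox : closure (cosbox b) `<=` ccosbox.
Proof.
move=> x clx i; rewrite !leNgt; apply/andP; split; apply/negP => xi.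
  have [y [/(_ i)/andP[yi _] /=]] :=
    clx _ (cvgr_lt _ (@coord_scale_continuous i x) _ xi).
  by rewrite ltNge ltW.
have [y [/(_ i)/andP[_ yi] /=]] :=
  clx _ (cvgr_gt _ (@coord_scale_continuous i x) _ xi).
by rewrite ltNge ltW.
Qed.

Lemma cosprod_gt0 x : cosbox b x -> 0 < cosprod b e x.
Proof.
by move=> bx; apply: prodr_gt0 => i _; rewrite powR_gt0// cosbox_gt0.
Qed.

(** On a face of the box one cosine is 0, and so is its power because the exponent is positive. *)
Lemma normcosprod_gt0_cosbox x : ccosbox x -> 0 < normcosprod x -> cosbox b x.
Proof.
move=> bx ux i; have /andP[l u] := bx i.
rewrite !lt_neqAle l u !andbT; apply/andP; split; apply/eqP => E.
  move: ux; rewrite /normcosprod (bigD1 i)//= -E cosN cos_pihalf normr0.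
  by rewrite powR0 ?gt_eqF// mul0r ltxx.
move: ux; rewrite /normcosprod (bigD1 i)//= E cos_pihalf normr0.
by rewrite powR0 ?gt_eqF// mul0r ltxx.
Qed.

Lemma within_cosprod_continuous (A : set 'rV[R]_N) : A `<=` ccosbox ->
  {within A, continuous (cosprod b e)}.
Proof.
move=> AB; apply: (@subspace_eq_continuous _ A _ normcosprod).
  by move=> x; rewrite inE => /AB; exact: normcosprodE.
exact/continuous_subspaceT/normcosprod_continuous.
Qed.

Lemma cosprod_boundary x : (closure (cosbox b) `\` interior (cosbox b)) x ->
  cosprod b e x = 0.
Proof.
move=> [/closure_cosbox bx]; rewrite (_ : interior _ = cosbox b) => [nbx|].
  rewrite -normcosprodE//; apply/eqP; rewrite eq_le leNgt; apply/andP; split.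
    by apply/negP => /(normcosprod_gt0_cosbox bx).
  by apply: prodr_ge0 => i _; exact: powR_ge0.
exact/interior_id/cosbox_open.
Qed.
End CosProductContinuity.

Lemma continuous_lsc_on (R : realType) (N : nat) (A : set 'rV[R]_N) u :
  {within A, continuous u} -> lsc_on A u.
Proof.
move=> cu x a /=; rewrite lte_fin => ax.
exists [set y | a < u y]; first exact: (cvgr_gt _ (cu x)).
by move=> y; rewrite lte_fin.
Qed.

Lemma continuous_usc_on (R : realType) (N : nat) (A : set 'rV[R]_N) u :
  {within A, continuous u} -> usc_on A u.
Proof.
by move=> cu; apply: continuous_lsc_on => x; apply: cvgN; exact: cu.
Qed.

(** * Viscosity inequalities *)

Lemma seq_argmax (T : eqType) (R : realType) (w : T -> R) (s : seq T) (y : T) :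
  y \in s -> exists2 m, m \in s & forall z, z \in s -> w z <= w m.
Proof.
elim: s y => // x [|x' s] IH y _.
  by exists x => [|z]; rewrite inE// => /eqP ->.
have [m ms mmax] := IH x' (mem_head _ _).
have [xm|mx] := leP (w x) (w m).
  by exists m => [|z]; rewrite inE ?ms ?orbT// => /predU1P[->|/mmax].
exists x => [|z]; first exact: mem_head.
by rewrite inE => /predU1P[->//|/mmax zm]; rewrite (le_trans zm)// ltW.
Qed.

(** Without a maximum, the sets where [w < w y], for [y] in [K], would cover [K]. In a finite
    subcover, the index with the largest value of [w] lies in none of the sets. *)
Lemma upper_semicontinuous_max (T : ptopologicalType) (R : realType) (K : set T)
    (w : T -> R) : compact K -> K !=set0 ->
  (forall x a, K x -> w x < a -> \forall y \near x, K y -> w y < a) ->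
  exists2 x, K x & forall y, K y -> w y <= w x.
Proof.
move=> cK [z0 Kz0] usc; apply: contrapT => nomax.
have up x : K x -> exists2 y, K y & w x < w y.
  move=> Kx; apply: contrapT => nx; apply: nomax; exists x => // y Ky.
  by rewrite leNgt; apply/negP => xy; apply: nx; exists y.
move: cK; rewrite compact_cover => cK.
have [||D DK KD] := cK T K (fun y => interior [set x | K x -> w x < w y]).
- by move=> y _; exact: open_interior.
- move=> x Kx; have [y Ky xy] := up x Kx; exists y => //.
  exact: usc.
have [y0 y0D _] := KD _ Kz0.
have [m mD mmax] : exists2 m, m \in finmap.enum_fset D &
    forall y, y \in finmap.enum_fset D -> w y <= w m by exact: seq_argmax y0D.
have Km : K m by have := DK m mD; rewrite inE.
have [y yD /interior_subset/(_ Km)] := KD _ Km.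
by rewrite ltNge => /negP; apply; exact: mmax.
Qed.

Section CosProductViscosity.
Variables (R : realType) (N : nat) (b e : 'I_N -> R) (mu : R).
Hypotheses (N0 : (0 < N)%N) (b0 : forall i, 0 < b i) (mu0 : 0 < mu).
Hypotheses (eb : forall i, e i * b i ^+ 2 = mu) (e1 : \sum_i e i = 1).

Let e0 i : 0 < e i. Proof. exact: (weight_gt0 b0 mu0 eb). Qed.

Lemma cosjet_center x eps : cosbox b x ->
  cosjet b e (ln (cosprod b e x)) eps x x = cosprod b e x.
Proof. by move=> bx; rewrite /cosjet expquad_center lnK// posrE cosprod_gt0. Qed.

(** A test function below the product is also below the upper comparison function [q], so its
    Hessian at [x] is at most that of [q]. The variance inequality bounds the latter by [eps - mu]
    times the value, and [eps] is arbitrary. *)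
Lemma cosprod_supersolution :
  viscosity_supersolution (cosbox b) mu (cosprod b e).
Proof.
split; first by apply/continuous_lsc_on/(within_cosprod_continuous e0)/cosboxW.
move=> x phi bx phiC2 touch; have u0 := cosprod_gt0 e bx.
rewrite -lerBrDr sub0r; apply/ler_addgt0Pr => d d0.
(* Scaled so that [eps * cosprod b e x = d]. *)
pose eps := d / cosprod b e x; have eps0 : 0 < eps by rewrite divr_gt0.
have -> : - (mu * cosprod b e x) + d = (eps - mu) * cosprod b e x.
  by rewrite mulrBl divfK ?gt_eqF// addrC.
apply: largest_eigenvalue_le => // [|v].
  exact: (hessian_sym (@cosbox_open _ _ b) phiC2 bx).
pose q := cosjet b e (ln (cosprod b e x)) eps x.
have qC2 : C2_on (cosbox b) q by exact: expquad_C2.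
apply: (@le_trans _ _ (qform (hessian q x) v)).
  apply: (qform_hessian_le v (@cosbox_open _ _ b) bx phiC2 qC2).
  apply: filterS2 touch (cosjet_ge e bx eps0) => y.
  by rewrite {2}/q cosjet_center// -/q; lra.
rewrite (qform_cosjet eb) lnK ?posrE// [X in _ <= X * _]mulrC -mulrA ler_pM2l//.
by rewrite gerDl subr_le0 (sqr_average_le b0 mu0 eb).
Qed.

(** Here the lower comparison function lies below the test function. The exact largest eigenvalue of
    its Hessian is used, hence the equality case of the variance inequality. *)
Lemma cosprod_subsolution : viscosity_subsolution (cosbox b) mu (cosprod b e).
Proof.
split; first by apply/continuous_usc_on/(within_cosprod_continuous e0)/cosboxW.
move=> x phi bx phiC2 touch; have u0 := cosprod_gt0 e bx.
rewrite -lerBlDr sub0r; apply/ler_addgt0Pr => d d0; rewrite -lerBlDr.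
pose eps := d / cosprod b e x; have eps0 : 0 < eps by rewrite divr_gt0.
have -> : - (mu * cosprod b e x) - d = (- eps - mu) * cosprod b e x.
  by rewrite mulrBl mulNr divfK ?gt_eqF// addrC.
pose q := cosjet b e (ln (cosprod b e x)) (- eps) x.
have qC2 : C2_on (cosbox b) q by exact: expquad_C2.
have <- : largest_eigenvalue (hessian q x) = (- eps - mu) * cosprod b e x.
  by rewrite (largest_eigenvalue_cosjet b0 mu0 eb)// lnK// posrE.
have bo := @cosbox_open _ _ b.
apply: largest_eigenvalue_le => // [|v]; first exact: (hessian_sym bo qC2 bx).
have [c _ [_ cmax]] := largest_eigenvalue_sym N0 (hessian_sym bo phiC2 bx).
apply: le_trans (cmax v).
apply: (qform_hessian_le v bo bx qC2 phiC2).
apply: filterS2 touch (cosjet_le e bx eps0) => y.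
by rewrite {2}/q cosjet_center// -/q; lra.
Qed.

(* Comparison with the eigenfunction of the slightly smaller box [cosbox (c b)],
   on whose closure phi is bounded away from 0. *)
Lemma eigenvalue_upper_bound (nu : R) (phi : 'rV[R]_N -> R) :
  (forall x, cosbox b x -> 0 < phi x) ->
  viscosity_supersolution (cosbox b) nu phi -> nu <= mu.
Proof.
move=> phi0 [phi_lsc phi_super]; rewrite leNgt; apply/negP => munu.
(* The box shrinks by the factor [c > 1], which multiplies its eigenvalue by [c ^+ 2]; the new value
   [mu'] is the midpoint of [mu] and [nu]. *)
pose c := Num.sqrt ((1 + nu / mu) / 2).
have c2 : c ^+ 2 = (1 + nu / mu) / 2.
  rewrite sqr_sqrtr// divr_ge0// addr_ge0// divr_ge0 ?(ltW mu0)// ltW//.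
  exact: lt_trans munu.
have numu : 1 < nu / mu by rewrite ltr_pdivlMr// mul1r.
have c1 : 1 < c.
  rewrite -(@ltr_pXn2r _ 2)// ?nnegrE ?sqrtr_ge0// c2; lra.
have c0 : 0 < c by rewrite (lt_trans _ c1).
pose b' i := c * b i; have b'0 i : 0 < b' i by rewrite mulr_gt0.
pose mu' := c ^+ 2 * mu.
have mu'nu : mu' < nu.
  have -> : mu' = (mu + nu) / 2 by rewrite /mu' c2; field; rewrite gt_eqF.
  lra.
have mu'0 : 0 < mu' by rewrite mulr_gt0// exprn_gt0.
have eb' i : e i * b' i ^+ 2 = mu' by rewrite /b' /mu' -(eb i); ring.
have KO : ccosbox b' `<=` cosbox b.
  move=> x bx i; have := bx i; rewrite -ler_norml -ltr_norml /b' -mulrA normrM.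
  rewrite gtr0_norm// mulrC -ler_pdivlMr// => /le_lt_trans; apply.
  by rewrite ltr_pdivrMr// ltr_pMr// divr_gt0// pi_gt0.
have Kcompact : compact (ccosbox b').
  rewrite (_ : ccosbox b' = [set v : 'rV[R]_N | forall i,
    `[- (pi / 2) / b' i, pi / 2 / b' i]%classic (v ord0 i)]).
    apply: (@rV_compact R N
      (fun i => `[- (pi / 2) / b' i, pi / 2 / b' i]%classic)) => i.
    exact: segment_compact.
  by apply/seteqP; split => v bv i; have := bv i;
    rewrite /= in_itv/= [_ / b' i <= _]ler_pdivrMr// [_ <= _ / b' i]ler_pdivlMr//
      (mulrC _ (b' i)).
have K0 : ccosbox b' 0.
  by move=> i; rewrite mxE mulr0 oppr_le0 andbb divr_ge0// pi_ge0.
pose u := normcosprod b' e.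
have u_cont : continuous u by exact: normcosprod_continuous.
have u_ge0 x : 0 <= u x by apply: prodr_ge0 => i _; exact: powR_ge0.
have usc (x : 'rV[R]_N) (a : R) : ccosbox b' x -> u x / phi x < a ->
    \forall y \near x, ccosbox b' y -> u y / phi y < a.
  move=> Kx; have phix := phi0 _ (KO _ Kx); rewrite ltr_pdivrMr// => uxa.
  have a0 : 0 < a by rewrite -(pmulr_lgt0 _ phix) (le_lt_trans (u_ge0 x)).
  (* A level strictly between [u x / a] and [phi x]: near [x], [phi] stays above [l] by lower
     semicontinuity and [u] stays below [a * l] by continuity. *)
  pose l := (u x / a + phi x) / 2.
  have uxl : u x / a < phi x by rewrite ltr_pdivrMr// mulrC.
  have lphi : l < phi x by rewrite /l; lra.
  have ul : u x < a * l by rewrite mulrC -ltr_pdivrMr// /l; lra.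
  have [V] := phi_lsc x l lphi.
  rewrite /nbhs/= -nbhs_subspace_in; last exact: KO.
  move=> nV Vphi; have {}nV : \forall y \near x, cosbox b y -> V y by exact: nV.
  have unear : \forall y \near x, u y < a * l.
    exact: (cvgr_lt _ (u_cont x) _ ul).
  apply: filterS2 nV unear => y Vy uy Ky.
  have yO := KO _ Ky; have := Vphi _ (Vy yO); rewrite lte_fin => ly.
  by rewrite ltr_pdivrMr ?phi0// (lt_trans uy)// ltr_pM2l.
have [x Kx xmax] := upper_semicontinuous_max Kcompact (ex_intro _ _ K0) usc.
have phix := phi0 _ (KO _ Kx).
(* The maximum of [u / phi] is positive because [u 0 = 1]. So the maximum point is in the open
   smaller box, where the comparison functions are available. *)
have ux : 0 < u x.
  have u0 : u 0 = 1.
    by apply: big1 => i _; rewrite mxE mulr0 cos0 normr1 powR1.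
  have : 0 < u x / phi x.
    apply: lt_le_trans (xmax _ K0); rewrite u0.
    by rewrite divr_gt0//; exact/phi0/KO.
  by rewrite pmulr_lgt0// invr_gt0.
have bx : cosbox b' x by exact: (normcosprod_gt0_cosbox e0).
have uE y : cosbox b' y -> u y = cosprod b' e y.
  by move=> /cosboxW; exact: normcosprodE.
pose eps := (nu - mu') / 2; have eps0 : 0 < eps by rewrite divr_gt0// subr_gt0.
(* This is [phi x / u x] times the lower comparison function of [u] at [x]. Near [x] it is at most
   [phi x / u x * u y], which is at most [phi y] by maximality of [u x / phi x]. *)
pose q := cosjet b' e (ln (phi x)) (- eps) x.
have qx : q x = phi x by rewrite /q /cosjet expquad_center lnK.
have := phi_super x q (KO _ Kx) (@expquad_C2 _ _ _ _ _ _ _).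
rewrite (largest_eigenvalue_cosjet b'0 mu'0 eb')// lnK ?posrE//.
have nO : \forall y \near x, cosbox b' y.
  by apply: open_nbhs_nbhs; split => //; exact: cosbox_open.
move=> /(_ _)/wrap[].
  apply: filterS2 nO (cosjet_le e bx eps0) => y by' jy.
  rewrite qx subrr subr_ge0.
  have qE : q y = phi x / u x * cosjet b' e (ln (cosprod b' e x)) (- eps) x y.
    rewrite /q /cosjet /expquad !expRD -uE// !lnK ?posrE// mulrA divfK//.
    by rewrite gt_eqF.
  rewrite qE (le_trans (ler_wpM2l _ jy)) ?divr_ge0 ?(ltW phix) ?(ltW ux)//.
  have Ky := cosboxW by'; have phiy := phi0 _ (KO _ Ky).
  have := xmax _ Ky; rewrite ler_pdivrMr// (uE y)// mulrAC ler_pdivlMr//.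
  by rewrite mulrAC ler_pdivrMr// mulrC (mulrC (u x)).
(* The supersolution inequality reads [- eps - mu' + nu <= 0] after division by [phi x], but
   [nu - mu'] is [2 * eps]. *)
rewrite -mulrDl pmulr_lle0// /eps; lra.
Qed.
End CosProductViscosity.

(** * The rectangle and its principal eigenvalue *)

Lemma Rect_cosbox (R : realType) (N : nat) (r : R) (alpha : 'I_N -> R) :
  0 < r -> (forall i, 0 < alpha i) ->
  Rect r alpha = cosbox (fun i => pi / (2 * r) * alpha i).
Proof.
move=> r0 alpha0.
have E i (s : R) : (- ((alpha i)^-1 * r) < s < (alpha i)^-1 * r) =
    (- (pi / 2) < pi / (2 * r) * alpha i * s < pi / 2).
  have -> : pi / 2 = pi / (2 * r) * alpha i * ((alpha i)^-1 * r).
    by field; rewrite !gt_eqF.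
  have k0 : 0 < pi / (2 * r) * alpha i.
    by rewrite mulr_gt0// divr_gt0 ?pi_gt0// mulr_gt0.
  by rewrite -(mulrN (pi / (2 * r) * alpha i)) !(ltr_pM2l k0).
by apply/seteqP; split => x bx i; have := bx i; rewrite E.
Qed.

Theorem theorem4 (R : realType) (N : nat) (hN : (2 <= N)%N)
    (r : R) (hr : 0 < r) (alpha : 'I_N -> R) (halpha : forall i, 0 < alpha i) :
  principal_eigenvalue (Rect r alpha) =
    ((\sum_(i < N) (alpha i ^+ 2)^-1)^-1 * (pi / (2 * r)) ^+ 2)%:E
  /\ exists p : 'I_N -> R, (forall i, -1 < p i) /\
       principal_eigenfunction (Rect r alpha)
         (fun x : 'rV[R]_N =>
            \prod_(i < N) cos (pi / (2 * r) * alpha i * x 0 i) `^ (p i + 1)^-1).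
Proof.
have N0 : (0 < N)%N by exact: leq_trans hN.
rewrite (Rect_cosbox hr halpha).
set S := \sum_i _; set k := pi / (2 * r); set mu := S^-1 * k ^+ 2.
pose b i := k * alpha i.
have k0 : 0 < k by rewrite divr_gt0 ?pi_gt0// mulr_gt0.
have b0 i : 0 < b i by rewrite mulr_gt0.
have S0 : 0 < S.
  rewrite /S (bigD1 (Ordinal N0))//= ltr_pwDl ?invr_gt0 ?exprn_gt0//.
  by apply: sumr_ge0 => i _; rewrite invr_ge0 sqr_ge0.
have mu0 : 0 < mu by rewrite mulr_gt0 ?invr_gt0// exprn_gt0.
(* These weights make [e i * b i ^+ 2] independent of [i]; the requirement that they sum to 1 is
   what fixes the value of [mu]. *)
pose e i := mu / b i ^+ 2.
have eb i : e i * b i ^+ 2 = mu by rewrite divfK// gt_eqF// exprn_gt0.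
have e1 : \sum_i e i = 1.
  rewrite (eq_bigr (fun i => S^-1 * (alpha i ^+ 2)^-1)).
    by rewrite -mulr_sumr mulVf// gt_eqF.
  by move=> i _; rewrite /e /mu /b; field; rewrite !gt_eqF.
have e0 i : 0 < e i by exact: (weight_gt0 b0 mu0 eb).
have super := cosprod_supersolution N0 b0 mu0 eb e1.
have eigE : principal_eigenvalue (cosbox b) = mu%:E.
  apply/eqP; rewrite eq_le; apply/andP; split.
    apply: ge_ereal_sup => _ [nu [phi [phi0 phi_super]] <-].
    by rewrite lee_fin; exact: (eigenvalue_upper_bound N0 b0 mu0 eb e1 phi0).
  apply: ereal_sup_ubound; exists mu => //; exists (cosprod b e).
  by split=> // x; exact: cosprod_gt0.
(* Chosen so that the exponent [(p i + 1)^-1] is [e i]. *)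
split=> //; exists (fun i => (e i)^-1 - 1); split=> [i|].
  by rewrite ltrBDl subrr invr_gt0.
rewrite (_ : (fun _ => _) = cosprod b e); last first.
  by apply/funext => x; apply: eq_bigr => i _; rewrite subrK invrK.
split.
- exact: (within_cosprod_continuous e0 (@closure_cosbox _ _ b)).
- by move=> x; exact: cosprod_gt0.
- by move=> x; exact: cosprod_boundary.
- by exists mu => //; split=> //; exact: (cosprod_subsolution N0 b0 mu0 eb e1).
Qed.
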